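(* Consider the fully discrete scheme $$U^{n+1}-U^n=\mathbf{i}\frac{\tau}{h^2}AU^{n+\frac12}+\mathbf{i}\lambda\tau F(U^{n+\frac12})U^{n+\frac12}+\mathbf{i}Z(U^{n+\frac12})\delta_{n+1}\beta,\qquad U^0=U(0)\in\mathcal{S},$$ with the notation of the context. For any initial value $U^0=U(0)\in\mathcal{S}$, there exists a unique solution $(U^n)_{n\in\mathbb{N}}$ of the scheme, and it possesses the discrete charge conservation law $$\|U^{n+1}\|^2=\|U^n\|^2=1,\qquad\forall\,n\in\mathbb{N}.$$
   Context: Notation. $M,K\in\mathbb{N}$ with $M\le K$; $h=\frac1{M+1}$; $x_j=jh$, $j=1,\dots,M$; $e_k(x)=\sqrt2\sin(k\pi x)$; $\eta_k>0$ with $\sum_{k=1}^\infty\eta_k<\infty$; $\lambda\in\{1,-1\}$. $\tau$ denotes the uniform time step, $t_n=n\tau$, $U^n=(u_1^n,\dots,u_M^n)^T\in\mathbb{C}^M$, $U^{n+\frac12}=\frac12(U^{n+1}+U^n)$, $\delta_{n+1}\beta=\beta(t_{n+1})-\beta(t_n)$, where $\beta(t)=(\beta_1(t),\dots,\beta_K(t))^T$ is a vector of independent real Brownian motions. $A\in\mathbb{R}^{M\times M}$ is the tridiagonal matrix with $-2$ on the diagonal and $1$ on the sub- and super-diagonals. For $U=(u_1,\dots,u_M)^T\in\mathbb{C}^M$, $F(U)=\mathrm{diag}\{|u_1|^2,\dots,|u_M|^2\}$ and $Z(U)=\mathrm{diag}\{u_1,\dots,u_M\}E_{MK}\Lambda$,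 where $E_{MK}=(e_k(x_j))_{1\le j\le M,\,1\le k\le K}$ and $\Lambda=\mathrm{diag}\{\sqrt{\eta_1},\dots,\sqrt{\eta_K}\}$. $\|\cdot\|$ is the Euclidean norm on $\mathbb{C}^M$ and $\mathcal{S}=\{U\in\mathbb{C}^M:\|U\|=1\}$. All equalities hold $\mathbb{P}$-almost surely.
   Formalization: Uniqueness is proved only for time steps τ < 2, since it fails for large τ (e.g. M = K = 1, λ = 1, τ = 10, where a step has three solutions with positive probability); existence and charge conservation are proved for every τ > 0. *)

(* Defs.v *)
From HB Require Import structures.
From mathcomp Require Import all_boot all_order all_algebra.
From mathcomp Require Import all_classical all_reals all_analysis.
From mathcomp.real_closed Require Import complex.

Set Implicit Arguments.
Unset Strict Implicit.
Unset Printing Implicit Defensive.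

Import Order.TTheory GRing.Theory Num.Theory.
Import numFieldNormedType.Exports.

Local Open Scope classical_set_scope.
Local Open Scope ring_scope.

Section probability_notions.
Context {d : measure_display} {T : measurableType d} {R : realType}.
Variable P : probability T R.

Definition mutually_independent (I : finType) (G : I -> set (set T)) : Prop :=
  forall (J : {set I}) (E : I -> set T),
    (forall i, i \in J -> G i (E i)) ->
    P (\bigcap_(i in [set` J]) E i) = (\prod_(i in J) P (E i))%E.

Definition increment (X : R -> {RV P >-> R}) (s t : R) : T -> R :=
  fun w => X t w - X s w.

Definition sigma_process (X : R -> {RV P >-> R}) : set (set T) :=
  <<s \bigcup_(t in [set t : R | 0 <= t])
        preimage_set_system setT (X t) measurable >>.

(* [normal_prob m s] is parametrised by the standard deviation [s]. *)
Record brownian_motion (X : R -> {RV P >-> R}) : Prop := BrownianMotion {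
  bm_start : {ae P, forall w, X 0 w = 0};
  bm_independent_increments : forall (m : nat) (t : nat -> R),
    0 <= t 0%N -> (forall i, t i <= t i.+1) ->
    mutually_independent (fun i : 'I_m =>
      preimage_set_system setT (increment X (t i) (t i.+1)) measurable);
  bm_gaussian_increments : forall s t : R, 0 <= s -> s < t ->
    forall B : set R, measurable B ->
    P (increment X s t @^-1` B) = normal_prob 0 (Num.sqrt (t - s)) B;
  bm_continuous_paths : {ae P, forall w,
    {within [set t : R | 0 <= t], continuous (fun t => X t w)}} }.

Definition independent_brownian_motions (K : nat)
    (beta : 'I_K -> R -> {RV P >-> R}) : Prop :=
  (forall k, brownian_motion (beta k)) /\
  mutually_independent (fun k => sigma_process (beta k)).

Definition random_cvector (M : nat) (X : T -> 'cV[R[i]]_M) : Prop :=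
  forall j : 'I_M, measurable_fun setT (fun w => complex.Re (X w j 0)) /\
                   measurable_fun setT (fun w => complex.Im (X w j 0)).

End probability_notions.

Section scheme.
Variable R : realType.

Definition cnorm (M : nat) (U : 'cV[R[i]]_M) : R :=
  Num.sqrt (\sum_(j < M) (complex.Re (U j 0) ^+ 2 + complex.Im (U j 0) ^+ 2)).

Definition unit_sphere (M : nat) : set 'cV[R[i]]_M := [set U | cnorm U = 1].

Definition mesh (M : nat) : R := M.+1%:R^-1.

(* The ordinals [j : 'I_M] and [k : 'I_K] stand for the one-based indices
   j + 1 and k + 1. *)
Definition grid_point (M : nat) (j : 'I_M) : R := j.+1%:R * mesh M.

Definition e_ (k : nat) (x : R) : R := Num.sqrt 2 * sin (k%:R * pi * x).

Definition laplacian_mx (M : nat) : 'M[R]_M :=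
  \matrix_(i, j) (if i == j then -2
                  else if (i.+1 == j :> nat) || (j.+1 == i :> nat) then 1
                  else 0).

Definition E_mx (M K : nat) : 'M[R]_(M, K) :=
  \matrix_(j, k) e_ k.+1 (grid_point j).

Definition Lambda_mx (K : nat) (eta : nat -> R) : 'M[R]_K :=
  diag_mx (\row_k Num.sqrt (eta k.+1)).

Definition to_C (m n : nat) (B : 'M[R]_(m, n)) : 'M[R[i]]_(m, n) :=
  map_mx (real_complex R) B.

(* Both factors are complex: the norm of [R[i]] takes its values in [R[i]]. *)
Definition F_mx (M : nat) (U : 'cV[R[i]]_M) : 'M[R[i]]_M :=
  diag_mx (\row_j `|U j 0| ^+ 2).

Definition Z_mx (M K : nat) (eta : nat -> R) (U : 'cV[R[i]]_M) :
    'M[R[i]]_(M, K) :=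
  diag_mx U^T *m to_C (E_mx M K) *m to_C (Lambda_mx K eta).

(* Written out so as not to depend on the abstract 'i of numClosedFieldType. *)
Definition iC : R[i] := Complex 0 1.

Definition midpoint (M : nat) (U V : 'cV[R[i]]_M) : 'cV[R[i]]_M :=
  2^-1 *: (V + U).

Definition scheme_step (M K : nat) (eta : nat -> R) (lambda tau : R)
    (U V : 'cV[R[i]]_M) (dbeta : 'cV[R]_K) : Prop :=
  let W := midpoint U V in
  V - U = (iC * (tau / mesh M ^+ 2)%:C%C) *: (to_C (laplacian_mx M) *m W)
        + (iC * (lambda * tau)%:C%C) *: (F_mx W *m W)
        + iC *: (Z_mx K eta W *m to_C dbeta).

Definition scheme_solution (d : measure_display) (T : measurableType d)
    (P : probability T R) (M K : nat) (eta : nat -> R) (lambda tau : R)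
    (beta : 'I_K -> R -> {RV P >-> R}) (U0 : 'cV[R[i]]_M)
    (U : nat -> T -> 'cV[R[i]]_M) : Prop :=
  [/\ forall n, random_cvector (U n),
      {ae P, forall w, U 0%N w = U0} &
      forall n, {ae P, forall w,
        scheme_step eta lambda tau (U n w) (U n.+1 w)
          (\col_k increment (beta k) (n%:R * tau) (n.+1%:R * tau) w)}].

End scheme.

(* Main.v *)
(* Written for the midpoint W, one step reads W - U = (i/2) H(W) W with H(W) a
   real symmetric matrix, which gives charge conservation. For uniqueness, the
   difference D of two midpoints satisfies |D|^2 <= (tau/2) |D|^2, because only
   the cubic term contributes and the entries of W have modulus <= 1.

   For existence, the matrix A being tridiagonal, the first entry z of W
   determines all the others ("shooting"), and W solves the step if and only if
   the entry at the right boundary node vanishes: two real polynomial equations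
   in the two real unknowns (Re z, Im z). Up to a sign, this entry is z times a
   large positive factor at infinity, so that on a large square the equations
   have the signs required by the two-dimensional Poincare-Miranda theorem. The
   latter follows from a parity count on finer and finer grids; choosing at each
   level the first cell with sign changes, and extracting convergent subsequences
   by a measurable version of the Bolzano-Weierstrass theorem, yields a zero that
   is a measurable function of the data. *)

Require Import Defs.
From HB Require Import structures.
From mathcomp Require Import all_boot all_order all_algebra.
From mathcomp Require Import all_classical all_reals all_analysis.
From mathcomp.real_closed Require Import complex.
From mathcomp Require Import measurable_realfun ring lra zify.

Set Implicit Arguments.
Unset Strict Implicit.
Unset Printing Implicit Defensive.

Import Order.TTheory GRing.Theory Num.Theory.
Import numFieldNormedType.Exports.

Local Open Scope classical_set_scope.
Local Open Scope ring_scope.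

(** * Parity argument on a grid *)

(* Each point carries its signs [(a, b)]; an edge counts if one end satisfies
   [a] and the other one [~~ a && b]. *)
Definition sign_edge (p q : bool * bool) : bool :=
  (p.1 (+) q.1) && (if p.1 then q.2 else p.2).

Definition mixed (a : nat -> nat -> bool) (i j : nat) : bool :=
  let s := [:: a i j; a i.+1 j; a i j.+1; a i.+1 j.+1] in
  has id s && has negb s.

(** If [a] is constant on the cell, no edge counts; if [b] is, then either no edge counts or the
    counted edges are the changes of [a] around a closed cycle, an even number. *)
Lemma sign_edge_cell (a b : nat -> nat -> bool) (i j : nat) :
  let e i j k l := sign_edge (a i j, b i j) (a k l, b k l) in
  ~~ (mixed a i j && mixed b i j) ->
  e i j i.+1 j (+) e i j.+1 i.+1 j.+1 = e i j i j.+1 (+) e i.+1 j i.+1 j.+1.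
Proof.
rewrite /mixed /sign_edge /=.
by case: (a i j) (a i.+1 j) (a i j.+1) (a i.+1 j.+1) => -[] [] [] /=;
   case: (b i j) (b i.+1 j) (b i j.+1) (b i.+1 j.+1) => -[] [] [].
Qed.

(* The number of edges of a cell that join a point with [a] to a point with
   [~~ a && b] is odd only if the cell is mixed for [a] and for [b]; around the
   whole square this number is odd, all such edges being on the top side. *)
Lemma mixed_cell (n : nat) (a b : nat -> nat -> bool) :
  (forall j, (j <= n)%N -> a n j) -> (forall j, (j <= n)%N -> ~~ a 0%N j) ->
  (forall i, (i <= n)%N -> b i n) -> (forall i, (i <= n)%N -> ~~ b i 0%N) ->
  exists i j, [/\ (i < n)%N, (j < n)%N & mixed a i j && mixed b i j].
Proof.
move=> aR aL bT bB; apply: contrapT => nex.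
have nmix i j : (i < n)%N -> (j < n)%N -> ~~ (mixed a i j && mixed b i j).
  by move=> lti ltj; apply/negP => mij; apply: nex; exists i, j.
pose e i j k l := sign_edge (a i j, b i j) (a k l, b k l).
pose H j m := \big[addb/false]_(0 <= i < m) e i j i.+1 j.
have Hrow j m : (j < n)%N -> (m <= n)%N ->
    H j m (+) H j.+1 m = e 0%N j 0%N j.+1 (+) e m j m j.+1.
  move=> ltj; elim: m => [|m IH] lem; first by rewrite /H !big_geq// !addbb.
  rewrite /H !big_nat_recr//= addbACA IH ?(ltnW lem)//.
  by rewrite (sign_edge_cell (nmix m j lem ltj)) addbA addbK.
(* The vertical edges left at both ends lie on the sides, where [a] is constant, so the parity
   [H j n] of counted edges is the same at every height [j]. *)
have HS j : (j < n)%N -> H j n = H j.+1 n.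
  move=> ltj; have := Hrow j n ltj (leqnn n).
  rewrite /e /sign_edge/= !aR ?(ltnW ltj)//.
  rewrite (negPf (aL j (ltnW ltj))) (negPf (aL j.+1 ltj))/=.
  by case: (H j n); case: (H j.+1 n).
have Hconst j : (j <= n)%N -> H j n = H 0%N n.
  by elim: j => // j IH ltj; rewrite -HS// IH// ltnW.
have H0 : H 0%N n = false.
  rewrite /H big_nat big1// => i lti.
  rewrite /e /sign_edge/= (negPf (bB i (ltnW lti))) (negPf (bB i.+1 lti)).
  by rewrite if_same andbF.
have Hn m : (m <= n)%N -> H n m = a 0%N n (+) a m n.
  elim: m => [|m IH] lem; first by rewrite /H big_geq// addbb.
  rewrite /H big_nat_recr//= [X in X (+) _]IH ?(ltnW lem)//.
  rewrite /e /sign_edge/= !bT ?(ltnW lem)// if_same andbT.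
  by rewrite addbA addbK.
by move: (Hconst n (leqnn n)); rewrite H0 Hn// aR// (negPf (aL n _)).
Qed.

(** * Measurable selection *)

(** The least index is measurable: its fibres are Boolean combinations of finitely many events
    [E k]. *)
Lemma measurable_first d (T : measurableType d) (E : nat -> T -> bool) :
  (forall k, measurable_fun setT (E k)) -> (forall w, exists k, E k w) ->
  exists N : T -> nat, measurable_fun setT N /\ forall w, E (N w) w.
Proof.
move=> mE exE; pose N w := ex_minn (exE w).
have NE w k : (N w == k) = E k w && ~~ [exists j : 'I_k, E j w].
  rewrite /N; case: ex_minnP => m Em minm; apply/eqP/andP => [<-|[Ek /existsPn nE]].
    by split=> //; apply/existsPn => j; apply/negP => /minm; rewrite leqNgt ltn_ord.
  apply/eqP; rewrite eqn_leq minm//= leqNgt; apply/negP => ltmk.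
  by have := nE (Ordinal ltmk); rewrite Em.
exists N; split=> [_ Y _|w]; last by rewrite /N; case: ex_minnP.
have mEk k : measurable [set w | E k w].
  by have := mE k measurableT [set true] I; rewrite setTI.
have -> : [set: T] `&` N @^-1` Y = \bigcup_(k in Y)
    ([set w | E k w] `&` ~` \bigcup_(j in [set j | (j < k)%N]) [set w | E j w]).
  apply/seteqP; split=> [w [_ /= YN]|w [k Yk [/= Ek nE]]].
    exists (N w) => //; have := NE w (N w); rewrite eqxx => /esym/andP[/= Ek /existsPn nE].
    by split=> // -[j /= ltj Ej]; have := nE (Ordinal ltj); rewrite Ej.
  split=> //=; suff /eqP -> : N w == k by [].
  rewrite NE Ek; apply/existsPn => j; apply/negP => Ej; apply: nE.
  by exists (j : nat) => /=.
apply: bigcup_measurable => k _; apply: measurableI => //.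
by apply: measurableC; apply: bigcup_measurable.
Qed.

Lemma measurable_select d d' (T : measurableType d) (T' : measurableType d')
    (x : nat -> T -> T') (N : T -> nat) :
  (forall k, measurable_fun setT (x k)) -> measurable_fun setT N ->
  measurable_fun setT (fun w => x (N w) w).
Proof.
move=> mx mN _ Y mY.
have -> : [set: T] `&` (fun w => x (N w) w) @^-1` Y =
    \bigcup_k (N @^-1` [set k] `&` x k @^-1` Y).
  by apply/seteqP; split=> [w [_ Yw]|w [k _ [<- Yw]]]; [exists (N w)|].
apply: bigcup_measurable => k _; apply: measurableI.
  by rewrite -[X in measurable X]setTI; exact: mN.
by rewrite -[X in measurable X]setTI; exact: mx.
Qed.

(** The limit superior is measurable and a cluster point; taking least indices close to it keeps the
    extraction measurable. *)
Lemma measurable_bolzano_weierstrass d (T : measurableType d) (R : realType)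
    (x : nat -> T -> R) (B : T -> R) :
  (forall n, measurable_fun setT (x n)) -> (forall n w, `|x n w| <= B w) ->
  exists (l : T -> R) (N : nat -> T -> nat),
    [/\ measurable_fun setT l, forall k, measurable_fun setT (N k),
        forall k w, (k <= N k w)%N &
        forall k w, `|x (N k w) w - l w| < k.+1%:R^-1].
Proof.
move=> mx xB.
have ub w : has_ubound (range (x ^~ w)).
  by exists (B w) => _ [n _ <-]; rewrite (le_trans (ler_norm _)).
have lb w : has_lbound (range (x ^~ w)).
  by exists (- B w) => _ [n _ <-]; have := xB n w; rewrite ler_norml => /andP[].
pose l w := limn_sup (x ^~ w).
have ml : measurable_fun setT l by exact: measurable_fun_limn_sup.
have cl w : sups (x ^~ w) @ \oo --> l w.
  apply/cvg_ex; exists (inf (range (sups (x ^~ w)))).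
  exact: cvg_sups_inf.
have near_l k w : exists n, (k <= n)%N && (`|x n w - l w| < k.+1%:R^-1).
  have /cvgrPdist_lt/(_ (k.+1%:R^-1 / 2)) := cl w.
  rewrite divr_gt0// => /(_ isT)[m _ /(_ (maxn m k) (leq_maxl _ _))/=].
  (* The supremum of a late tail is within half the tolerance of the limit, and some term of that
     tail is within the other half of the supremum. *)
  pose S := sdrop (x ^~ w) (maxn m k); rewrite -[sups _ _]/(sup S) => Sl.
  have e0 : 0 < k.+1%:R^-1 / 2 :> R by rewrite divr_gt0.
  have [|_ [n /= len <-] Sn] := @sup_adherent _ S _ e0.
    split; first by exists (x (maxn m k) w), (maxn m k) => /=.
    exact/has_ubound_sdrop/ub.
  exists n; rewrite (leq_trans (leq_maxr _ _) len)/=.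
  have xS : x n w <= sup S.
    by apply: ub_le_sup; [exact/has_ubound_sdrop/ub|exists n].
  have aux (e s y z : R) : 0 < e / 2 -> `|z - s| < e / 2 -> s - e / 2 < y ->
      y <= s -> `|y - z| < e.
    by rewrite !ltr_norml => h /andP[h1 h2] h3 h4; apply/andP; split; lra.
  exact: aux e0 Sl Sn xS.
have /choice[N HN] : forall k, exists N : T -> nat,
    measurable_fun setT N /\ forall w, (k <= N w)%N && (`|x (N w) w - l w| < k.+1%:R^-1).
  move=> k; apply: (@measurable_first _ _
    (fun n w => (k <= n)%N && (`|x n w - l w| < k.+1%:R^-1))) => // n.
  apply: measurable_and => //; apply: measurable_fun_ltr => //.
  apply: measurableT_comp => //; exact: measurable_funB.
exists l, N; split=> // k; first by have [] := HN k.
  by move=> w; have [_ /(_ w)/andP[]] := HN k.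
by move=> w; have [_ /(_ w)/andP[]] := HN k.
Qed.

(** * Common zeros as limits of mixed cells *)

Lemma measurable_mixed d (T : measurableType d) (a : T -> nat -> nat -> bool)
    (i j : nat) :
  (forall i j, measurable_fun setT (fun w => a w i j)) ->
  measurable_fun setT (fun w => mixed (a w) i j).
Proof.
move=> ma; rewrite /mixed /=; apply: measurable_and.
  by do 4![apply: measurable_or => //].
by do 4![apply: measurable_or => //; first exact: measurable_neg].
Qed.

Lemma mixed_ltr0 (R : realDomainType) (f : nat -> nat -> R) (i j : nat) :
  mixed (fun i j => 0 < f i j) i j ->
  (exists i' j', [/\ (i <= i' <= i.+1)%N, (j <= j' <= j.+1)%N & 0 < f i' j']) /\
  (exists i' j', [/\ (i <= i' <= i.+1)%N, (j <= j' <= j.+1)%N & f i' j' <= 0]).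
Proof.
rewrite /mixed /= !orbF -!leNgt => /andP[p n]; split.
  by case/or4P: p => h; [exists i, j|exists i.+1, j|exists i, j.+1|exists i.+1, j.+1];
    split; rewrite ?leqnn ?leqnSn.
by case/or4P: n => h; [exists i, j|exists i.+1, j|exists i, j.+1|exists i.+1, j.+1];
    split; rewrite ?leqnn ?leqnSn.
Qed.

Lemma ge0_of_near (R : realType) (V : pseudoMetricType R) (f : V -> R) (z : V) :
  {for z, continuous f} ->
  (forall e : R, 0 < e -> exists2 z', ball z e z' & 0 <= f z') -> 0 <= f z.
Proof.
move=> cf H; rewrite leNgt; apply/negP => fz0.
have /cf/nbhs_ballP[e /= e0 he] : nbhs (f z) [set y : R | y < 0].
  by apply: open_nbhs_nbhs; split => //; exact: open_lt.
by have [z' /he/= + fz'] := H e e0; rewrite ltNge fz'.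
Qed.

Lemma eq0_of_near (R : realType) (V : pseudoMetricType R) (f : V -> R) (z : V) :
  {for z, continuous f} ->
  (forall e : R, 0 < e -> exists2 z', ball z e z' & 0 <= f z') ->
  (forall e : R, 0 < e -> exists2 z', ball z e z' & f z' <= 0) -> f z = 0.
Proof.
move=> cf ge le; apply/eqP; rewrite eq_le ge0_of_near// andbT -oppr_ge0.
apply: (@ge0_of_near _ _ (fun z => - f z)) => [|e /le[z' bz fz']].
  exact: continuousN.
by exists z' => //; rewrite oppr_ge0.
Qed.

Definition grid (R : realType) (N n i : nat) : R :=
  - N%:R + 2 * N%:R * i%:R / n.+1%:R.

Lemma grid_norm (R : realType) (N n i : nat) : (i <= n.+1)%N ->
  `|grid R N n i| <= N%:R.
Proof.
move=> lei; have h1 : 0 <= i%:R / n.+1%:R :> R by rewrite divr_ge0.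
have h2 : i%:R / n.+1%:R <= 1 :> R by rewrite ler_pdivrMr// mul1r ler_nat.
have aux (x t : R) : 0 <= x -> 0 <= t -> t <= 1 -> `|- x + 2 * x * t| <= x.
  by move=> x0 t0 t1; rewrite ler_norml; apply/andP; split; nra.
by rewrite /grid -mulrA aux.
Qed.

Lemma grid0 (R : realType) (N n : nat) : grid R N n 0 = - N%:R.
Proof. by rewrite /grid mulr0 mul0r addr0. Qed.

Lemma gridn (R : realType) (N n : nat) : grid R N n n.+1 = N%:R.
Proof. by rewrite /grid mulfK ?pnatr_eq0//; ring. Qed.

Lemma grid_dist (R : realType) (N n i i' : nat) : (i <= i' <= i.+1)%N ->
  `|grid R N n i - grid R N n i'| <= 2 * N%:R / n.+1%:R.
Proof.
move=> /andP[h1 h2]; rewrite /grid.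
have -> : - N%:R + 2 * N%:R * i%:R / n.+1%:R - (- N%:R + 2 * N%:R * i'%:R / n.+1%:R) =
  2 * N%:R / n.+1%:R * (i%:R - i'%:R) :> R by ring.
rewrite normrM ger0_norm ?divr_ge0// ?mulr_ge0//.
rewrite ler_piMr ?divr_ge0// ?mulr_ge0//.
rewrite distrC ger0_norm ?subr_ge0 ?ler_nat// -natrB// (ler_nat _ _ 1%N).
by rewrite leq_subLR addn1.
Qed.

(** A Poincare-Miranda theorem with a parameter: the square, the cells and the subsequences are all
    given by first admissible indices, hence measurable in [w]. *)
Theorem measurable_zero d (T : measurableType d) (R : realType)
    (P Q : T -> R -> R -> R) :
  (forall x y : T -> R, measurable_fun setT x -> measurable_fun setT y ->
     measurable_fun setT (fun w => P w (x w) (y w)) /\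
     measurable_fun setT (fun w => Q w (x w) (y w))) ->
  (forall w, continuous (fun z : R * R => P w z.1 z.2) /\
             continuous (fun z : R * R => Q w z.1 z.2)) ->
  (forall w, exists N : nat, forall t : R, `|t| <= N%:R ->
     [/\ 0 < P w N%:R t, P w (- N%:R) t < 0, 0 < Q w t N%:R & Q w t (- N%:R) < 0]) ->
  exists x y : T -> R, [/\ measurable_fun setT x, measurable_fun setT y &
    forall w, P w (x w) (y w) = 0 /\ Q w (x w) (y w) = 0].
Proof.
move=> mPQ cPQ sides.
pose g := grid R.
(* [k] encodes the cell with column [k %/ n.+1] and row [k %% n.+1]; the remainder is in range by
   itself. *)
pose C N n k w := [&& (k %/ n.+1 < n.+1)%N,
  mixed (fun i j => 0 < P w (g N n i) (g N n j)) (k %/ n.+1) (k %% n.+1) &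
  mixed (fun i j => 0 < Q w (g N n i) (g N n j)) (k %/ n.+1) (k %% n.+1)].
have mC N n k : measurable_fun setT (C N n k).
  apply: measurable_and; first exact: measurable_cst.
  apply: measurable_and; apply: measurable_mixed => i j;
    apply: measurable_fun_ltr; try exact: measurable_cst.
  - by have [] := mPQ (cst (g N n i)) (cst (g N n j)) (measurable_cst _) (measurable_cst _).
  - by have [] := mPQ (cst (g N n i)) (cst (g N n j)) (measurable_cst _) (measurable_cst _).
(* The size is selected by a countable, hence measurable, condition: every grid has a cell mixed for
   both functions. The sign conditions on the sides, which involve uncountably many [t], serve to
   show that such a size exists. *)
have [Nw [mN NC]] : exists N : T -> nat, measurable_fun setT N /\
    forall w, `[< forall n, exists k, C (N w) n k w >].
  apply: (measurable_first (E := fun N w => `[< forall n, exists k, C N n k w >])).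
    move=> N; apply: (measurable_fun_bool true); rewrite setTI.
    have -> : (fun w => `[< forall n, exists k, C N n k w >]) @^-1` [set true] =
        \bigcap_n \bigcup_k (C N n k @^-1` [set true]).
      apply/seteqP; split=> w /=.
        by move=> /asboolP h n _; have [k hk] := h n; exists k.
      by move=> h; apply/asboolP => n; have [k _ hk] := h n I; exists k.
    apply: bigcapT_measurable => n; apply: bigcup_measurable => k _.
    by rewrite -[X in measurable X]setTI; exact: mC.
  move=> w; have [N HN] := sides w; exists N; apply/asboolP => n.
  have gN i : (i <= n.+1)%N -> `|g N n i| <= N%:R by exact: grid_norm.
  have [||||i [j [lti ltj]]] := @mixed_cell n.+1
    (fun i j => 0 < P w (g N n i) (g N n j)) (fun i j => 0 < Q w (g N n i) (g N n j)).
  - by move=> j /gN/HN[+ _ _ _]; rewrite /g gridn.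
  - by move=> j /gN/HN[_ + _ _]; rewrite /g grid0 -leNgt => /ltW.
  - by move=> i /gN/HN[_ _ + _]; rewrite /g gridn.
  - by move=> i /gN/HN[_ _ _]; rewrite /g grid0 -leNgt => /ltW.
  move=> /andP[mP mQ]; exists (i * n.+1 + j)%N; rewrite /C.
  by rewrite divnMDl// divn_small// addn0 modnMDl modn_small// lti mP mQ.
have /choice[K HK] : forall n, exists K : T -> nat,
    measurable_fun setT K /\ forall w, C (Nw w) n (K w) w.
  move=> n; apply: (measurable_first (E := fun k w => C (Nw w) n k w)).
    by move=> k; apply: (measurable_select (x := fun N => C N n k)).
  by move=> w; have /asboolP/(_ n) := NC w.
pose px n w := g (Nw w) n (K n w %/ n.+1)%N.
pose py n w := g (Nw w) n (K n w %% n.+1)%N.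
have mp (h : nat -> nat) n : measurable_fun setT (fun w => g (Nw w) n (h (K n w))).
  apply: (measurable_select (x := fun N w => g N n (h (K n w)))) => // N.
  apply: (measurable_select (x := fun k (w : T) => g N n (h k))); last by have [] := HK n.
  by move=> k; exact: measurable_cst.
have bx n w : `|px n w| <= (Nw w)%:R.
  by apply: grid_norm; have [_ /(_ w)/andP[/ltnW]] := HK n.
have by_ n w : `|py n w| <= (Nw w)%:R.
  by apply: grid_norm; rewrite ltnW// ltn_mod.
have [x [Nx [mx mNx leNx xlim]]] := measurable_bolzano_weierstrass (fun n => mp (fun k => k %/ n.+1)%N n) bx.
have mpy k : measurable_fun setT (fun w => py (Nx k w) w).
  by apply: measurable_select => // n; exact: (mp (fun k => k %% n.+1)%N).
(* The second extraction runs along the first one, so that stage [k] uses the grid of index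
   [Nx (Ny k w) w]. *)
have [y [Ny [my mNy leNy ylim]]] :=
  measurable_bolzano_weierstrass mpy (fun k w => by_ (Nx k w) w).
exists x, y; split=> // w.
have near_zero (e : R) : 0 < e -> exists n,
    [/\ `|x w - px n w| + 2 * (Nw w)%:R / n.+1%:R < e &
        `|y w - py n w| + 2 * (Nw w)%:R / n.+1%:R < e].
  move=> e0; have c0 : 0 < 1 + 2 * (Nw w)%:R :> R by rewrite ltr_pwDl// mulr_ge0.
  (* The [1] covers the distance from the corner of the cell to the limit, the rest the width of the
     cell, the grid index being at least [k]. *)
  have [k hk] : exists k : nat, (1 + 2 * (Nw w)%:R) / k.+1%:R < e.
    have [k _ /(_ _ (leqnn k))/= hk] :=
      near_infty_natSinv_lt (PosNum (divr_gt0 e0 c0)).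
    by exists k; rewrite mulrC -ltr_pdivlMr.
  have leS m : (k <= m)%N -> m.+1%:R^-1 <= k.+1%:R^-1 :> R.
    by move=> lekm; rewrite lef_pV2 ?posrE// ler_nat.
  have N0 : 0 <= 2 * (Nw w)%:R :> R by rewrite mulr_ge0.
  have len := leq_trans (leNy k w) (leNx (Ny k w) w).
  exists (Nx (Ny k w) w); split; apply: le_lt_trans hk; rewrite [leRHS]mulrDl mul1r lerD//.
  - by rewrite distrC (le_trans (ltW (xlim _ _)))// leS// leNy.
  - by rewrite ler_wpM2l// leS.
  - by rewrite distrC (ltW (ylim _ _)).
  - by rewrite ler_wpM2l// leS.
have [cP cQ] := cPQ w.
have near_pt e : 0 < e -> exists N n i j,
  [/\ mixed (fun i j => 0 < P w (g N n i) (g N n j)) i j,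
      mixed (fun i j => 0 < Q w (g N n i) (g N n j)) i j &
      forall i' j', (i <= i' <= i.+1)%N -> (j <= j' <= j.+1)%N ->
        ball ((x w, y w) : R * R) e (g N n i', g N n j')].
  move=> e0; have [n [hx hy]] := near_zero e e0.
  exists (Nw w), n, (K n w %/ n.+1)%N, (K n w %% n.+1)%N.
  have [_ /(_ w)/and3P[_ mP mQ]] := HK n; split=> // i' j' hi hj.
  split; rewrite -ball_normE /=.
    apply: le_lt_trans hx; rewrite (le_trans (ler_distD (px n w) _ _))// lerD2l.
    exact: grid_dist.
  apply: le_lt_trans hy; rewrite (le_trans (ler_distD (py n w) _ _))// lerD2l.
  exact: grid_dist.
split.
  apply: (@eq0_of_near _ _ (fun z : R * R => P w z.1 z.2) (x w, y w) (cP _)).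
  - move=> e e0; have [N [n [i [j [/mixed_ltr0[[i' [j' [hi hj /ltW h]]] _] _ B]]]]] := near_pt e e0.
    by exists (g N n i', g N n j') => //; exact: B.
  - move=> e e0; have [N [n [i [j [/mixed_ltr0[_ [i' [j' [hi hj h]]]] _ B]]]]] := near_pt e e0.
    by exists (g N n i', g N n j') => //; exact: B.
apply: (@eq0_of_near _ _ (fun z : R * R => Q w z.1 z.2) (x w, y w) (cQ _)).
- move=> e e0; have [N [n [i [j [_ /mixed_ltr0[[i' [j' [hi hj /ltW h]]] _] B]]]]] := near_pt e e0.
  by exists (g N n i', g N n j') => //; exact: B.
- move=> e e0; have [N [n [i [j [_ /mixed_ltr0[_ [i' [j' [hi hj h]]]] B]]]]] := near_pt e e0.
  by exists (g N n i', g N n j') => //; exact: B.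
Qed.

(** * Shooting *)

Section cubic_growth.
Variable R : realType.

(** [P] and [Q] are the components of a trajectory: each step multiplies them by [kappa] times the
    squared modulus, up to an error affine in the moduli at the last two nodes. *)
Definition cubic_recursion (C kappa : R) (P Q : nat -> R) : Prop :=
  forall n, let S := `|P n.+1| + `|Q n.+1| + `|P n| + `|Q n| + 1 in
    let s := kappa * (P n.+1 ^+ 2 + Q n.+1 ^+ 2) in
    `|P n.+2 - s * P n.+1| <= C * S /\ `|Q n.+2 - s * Q n.+1| <= C * S.

(** With the change of sign below, this symmetry reduces the four sides of the square to the one
    where [P] starts at its positive bound. *)
Lemma cubic_recursion_swap (C kappa : R) (P Q : nat -> R) :
  cubic_recursion C kappa P Q -> cubic_recursion C kappa Q P.
Proof.
move=> h n /=; have [] := h n.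
rewrite [Q _ ^+ 2 + _]addrC [`|Q n.+1| + _]addrC.
by rewrite -[in X in _ -> _ -> X]addrA -[in X in _ -> _ -> X]addrA
  [in X in _ -> _ -> X](addrCA `|Q n|) !addrA.
Qed.

Lemma cubic_recursionN (C kappa : R) (P Q : nat -> R) :
  cubic_recursion C kappa P Q -> cubic_recursion C kappa (fun n => - P n) Q.
Proof. by move=> h n /=; have [] := h n; rewrite !normrN sqrrN mulrN -opprD normrN. Qed.

(** The error is at most [D * p] with [D = C * (2 + 2 * k)], and [s] is at least [2 * D + 2]. Hence
    [p'] is at least [(s / 2 + 1) * p], while the modulus of [q'] is at most [(s * k + D) * p], and
    their ratio stays below [2 * k + 1]. *)
Lemma cubic_growth_step (C kappa k L p q p0 q0 p' q' : R) :
  0 < kappa -> 0 <= C -> 1 <= k -> 1 <= L ->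
  2 * (C * (2 + 2 * k)) + 2 <= kappa * L ->
  L <= p -> `|q| <= k * p -> `|p0| + `|q0| <= k * p ->
  let S := `|p| + `|q| + `|p0| + `|q0| + 1 in
  let s := kappa * (p ^+ 2 + q ^+ 2) in
  `|p' - s * p| <= C * S -> `|q' - s * q| <= C * S ->
  [/\ L <= p', `|q'| <= (2 * k + 1) * p' & `|p| + `|q| <= (2 * k + 1) * p'].
Proof.
move=> kap0 C0 k1 L1 hL Lp hq hpq S s hp' hq'.
have p1 : 1 <= p by exact: le_trans L1 Lp.
have p0' : 0 < p by lra.
set D := C * (2 + 2 * k) in hL.
have hS : C * S <= D * p.
  rewrite /D -mulrA ler_wpM2l// /S (ger0_norm (ltW p0')); nra.
have hs : 2 * D + 2 <= s.
  apply: (le_trans hL); rewrite /s ler_pM2l// (le_trans Lp)//.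
  by have := sqr_ge0 q; nra.
have hpp : (s / 2 + 1) * p <= p'.
  have := le_trans hp' hS; rewrite ler_norml => /andP[h _].
  have : (s / 2 + 1) * p <= (s - D) * p by rewrite ler_pM2r//; lra.
  lra.
have D0 : 0 <= D by rewrite /D mulr_ge0//; lra.
have hqq : `|q'| <= (s * k + D) * p.
  have -> : q' = (q' - s * q) + s * q by ring.
  rewrite (le_trans (ler_normD _ _))// addrC mulrDl lerD//; last exact: le_trans hq' hS.
  by rewrite normrM (ger0_norm (_ : 0 <= s))//; [rewrite -mulrA ler_wpM2l//; lra|lra].
have hk : (2 * k + 1) * ((s / 2 + 1) * p) <= (2 * k + 1) * p'.
  by rewrite ler_wpM2l//; lra.
split.
- apply: (le_trans Lp); apply: le_trans hpp; rewrite ler_peMl//; lra.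
- apply: (le_trans hqq); apply: le_trans hk; rewrite mulrA ler_pM2r//; nra.
- rewrite (ger0_norm (ltW p0')); apply: le_trans hk.
  apply: (@le_trans _ _ ((1 + k) * p)); first by rewrite mulrDl mul1r lerD2l.
  rewrite mulrA ler_pM2r//; nra.
Qed.

(* The invariant: the leading component dominates the other one and the
   preceding node, so the lower-order terms of the recursion are negligible
   against the cubic one. *)
Lemma cubic_growth (C kappa : R) (M : nat) : 0 < kappa -> 0 <= C ->
  exists L0 : R, forall (L : R) (P Q : nat -> R), L0 <= L ->
    cubic_recursion C kappa P Q ->
    P 0%N = 0 -> Q 0%N = 0 -> P 1%N = L -> `|Q 1%N| <= L -> 0 < P M.+1.
Proof.
move=> kap0 C0.
suff [k [L0 [_ L01 H]]] : exists k L0 : R, [/\ 1 <= k, 1 <= L0 &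
    forall (L : R) (P Q : nat -> R), L0 <= L ->
    cubic_recursion C kappa P Q ->
    P 0%N = 0 -> Q 0%N = 0 -> P 1%N = L -> `|Q 1%N| <= L ->
    [/\ L <= P M.+1, `|Q M.+1| <= k * P M.+1 & `|P M| + `|Q M| <= k * P M.+1]].
  exists L0 => L P Q LL rec P0 Q0 P1 Q1; have [LP _ _] := H L P Q LL rec P0 Q0 P1 Q1.
  by apply: lt_le_trans LP; lra.
elim: M => [|M [k [L0 [k1 L01 IH]]]].
  exists 1, 1; split=> // L P Q L1 rec P0 Q0 P1 Q1.
  by rewrite P0 Q0 P1 !mul1r normr0 addr0; split=> //; lra.
(* The ratio worsens from [k] to [2 * k + 1], and the threshold is raised so that [kappa * L]
   absorbs the error for the ratio [k]. *)
exists (2 * k + 1), (Num.max L0 ((2 * (C * (2 + 2 * k)) + 2) / kappa)).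
split; [lra|by rewrite le_max L01|move=> L P Q].
rewrite ge_max => /andP[L0L]; rewrite ler_pdivrMr// [L * _]mulrC => hL rec P0 Q0 P1 Q1.
have [h1 h2 h3] := IH L P Q L0L rec P0 Q0 P1 Q1.
have [rP rQ] := rec M.
exact: cubic_growth_step kap0 C0 k1 (le_trans L01 L0L) hL h1 h2 h3 rP rQ.
Qed.

End cubic_growth.

Section shooting.
Variable R : realType.

(** The scheme at one node, solved for the right neighbour: [z] and [z'] are the midpoint at this
    node and at the left one, [a + i b] is the old state, [xi] the noise potential, [c] stands for
    [h^2 / tau] and [mu] for [lambda * tau]. *)
Definition shoot_next (c mu a b xi : R) (z z' : R * R) : R * R :=
  let f := mu * (z.1 ^+ 2 + z.2 ^+ 2) + xi in
  (2 * z.1 - z'.1 + c * (2 * (z.2 - b) - f * z.1),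
   2 * z.2 - z'.2 - c * (2 * (z.1 - a) + f * z.2)).

(* Index 0 is the left boundary node, so that the entry [j : 'I_M] of the
   midpoint has index [j.+1] and the right boundary node has index [M.+1]. *)
Fixpoint shoot (c mu : R) (a b xi : nat -> R) (z : R * R) (n : nat) : R * R :=
  match n with
  | 0 => (0, 0)
  | n'.+1 => match n' with
    | 0 => z
    | m.+1 => shoot_next c mu (a m) (b m) (xi m)
                (shoot c mu a b xi z n') (shoot c mu a b xi z m)
    end
  end.

Lemma shootSS (c mu : R) (a b xi : nat -> R) (z : R * R) (n : nat) :
  shoot c mu a b xi z n.+2 = shoot_next c mu (a n) (b n) (xi n)
    (shoot c mu a b xi z n.+1) (shoot c mu a b xi z n).
Proof. by []. Qed.

Lemma shoot_measurable d (T : measurableType d) (c mu : R)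
    (a b xi : nat -> T -> R) (x y : T -> R) (n : nat) :
  (forall n, measurable_fun setT (a n)) -> (forall n, measurable_fun setT (b n)) ->
  (forall n, measurable_fun setT (xi n)) ->
  measurable_fun setT x -> measurable_fun setT y ->
  let s w := shoot c mu (a ^~ w) (b ^~ w) (xi ^~ w) (x w, y w) n in
  measurable_fun setT (fun w => (s w).1) /\ measurable_fun setT (fun w => (s w).2).
Proof.
move=> ma mb mxi mx my /=.
pose ok n := let s w := shoot c mu (a ^~ w) (b ^~ w) (xi ^~ w) (x w, y w) n in
  measurable_fun setT (fun w => (s w).1) /\ measurable_fun setT (fun w => (s w).2).
suff [] : ok n /\ ok n.+1 by [].
elim: n => [|n [[m1 m2] [m3 m4]]]; first by split.
split=> //; rewrite /ok; split; under eq_fun do rewrite shootSS /shoot_next /=.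
  by do ?[apply: measurable_funB|apply: measurable_funD|apply: measurable_funM|
          apply: measurable_funX|exact: measurable_cst|assumption].
by do ?[apply: measurable_funB|apply: measurable_funD|apply: measurable_funM|
          apply: measurable_funX|exact: measurable_cst|assumption].
Qed.

Lemma shoot_next_continuous (V : topologicalType) (c mu a b xi : R)
    (f g : V -> R * R) :
  continuous (fun v => (f v).1) -> continuous (fun v => (f v).2) ->
  continuous (fun v => (g v).1) -> continuous (fun v => (g v).2) ->
  continuous (fun v => (shoot_next c mu a b xi (f v) (g v)).1) /\
  continuous (fun v => (shoot_next c mu a b xi (f v) (g v)).2).
Proof.
move=> f1 f2 g1 g2.
have K (r : R) : continuous (fun _ : V => r) by move=> ?; exact: cvg_cst.
have D (h k : V -> R) : continuous h -> continuous k -> continuous (fun v => h v + k v).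
  by move=> ch ck v; exact: cvgD (ch v) (ck v).
have N (h : V -> R) : continuous h -> continuous (fun v => - h v).
  by move=> ch v; exact: cvgN (ch v).
have X (h k : V -> R) : continuous h -> continuous k -> continuous (fun v => h v * k v).
  by move=> ch ck v; exact: cvgM (ch v) (ck v).
have F := D _ _ (X _ _ (K mu) (D _ _ (X _ _ f1 f1) (X _ _ f2 f2))) (K xi).
split.
  exact: D _ _ (D _ _ (X _ _ (K 2) f1) (N _ g1))
    (X _ _ (K c) (D _ _ (X _ _ (K 2) (D _ _ f2 (N _ (K b)))) (N _ (X _ _ F f1)))).
exact: D _ _ (D _ _ (X _ _ (K 2) f2) (N _ g2))
  (N _ (X _ _ (K c) (D _ _ (X _ _ (K 2) (D _ _ f1 (N _ (K a)))) (X _ _ F f2)))).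
Qed.

Lemma shoot_continuous (c mu : R) (a b xi : nat -> R) (n : nat) :
  continuous (fun z : R * R => (shoot c mu a b xi z n).1) /\
  continuous (fun z : R * R => (shoot c mu a b xi z n).2).
Proof.
pose ok n := continuous (fun z : R * R => (shoot c mu a b xi z n).1) /\
  continuous (fun z : R * R => (shoot c mu a b xi z n).2).
suff [] : ok n /\ ok n.+1 by [].
elim: n => [|n [[m1 m2] [m3 m4]]].
  split; split=> z /=; [exact: cvg_cst|exact: cvg_cst|exact: cvg_fst|exact: cvg_snd].
split=> //; exact: shoot_next_continuous.
Qed.

(* [sigma = - lambda]: the cubic term flips the sign by [sigma] at every node. *)
Lemma shoot_cubic_recursion (c mu sigma kappa B : R) (a b xi : nat -> R) (z : R * R) :
  0 <= c -> sigma ^+ 2 = 1 -> c * mu = - (sigma * kappa) ->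
  (forall n, [/\ `|a n| <= B, `|b n| <= B & `|xi n| <= B]) ->
  cubic_recursion (2 + c * (2 + 2 * B)) kappa
    (fun n => sigma ^+ n.+1 * (shoot c mu a b xi z n).1)
    (fun n => sigma ^+ n.+1 * (shoot c mu a b xi z n).2).
Proof.
move=> c0 sg2 cmu bound n /=; rewrite -/(shoot c mu a b xi z n.+1).
have [aB bB xiB] := bound n.
have B0 : 0 <= B by exact: le_trans aB.
have nsg : `|sigma| = 1.
  by apply/eqP; rewrite -(@eqrXn2 _ 2)// expr1n real_normK ?num_real// sg2.
have sgn m x : `|sigma ^+ m * x| = `|x| by rewrite normrM normrX nsg expr1n mul1r.
have sg4 m x : (sigma ^+ m * x) ^+ 2 = x ^+ 2 by rewrite exprMn exprAC sg2 expr1n mul1r.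
rewrite -/(shoot_next c mu (a n) (b n) (xi n) (shoot c mu a b xi z n.+1) (shoot c mu a b xi z n)).
move: (shoot _ _ _ _ _ _ n.+1) (shoot _ _ _ _ _ _ n) => [p q] [p0 q0] /=.
rewrite !sgn !sg4.
have key (f u v v0 e : R) : `|e| <= B -> f = c * mu * (p ^+ 2 + q ^+ 2) + c * xi n ->
  `|sigma ^+ n.+3 * (2 * u - v0 + c * (2 * (v - e)) - f * u) -
    kappa * (p ^+ 2 + q ^+ 2) * (sigma ^+ n.+2 * u)| <= 
  (2 + c * (2 + 2 * B)) * (`|u| + `|v| + `|v0| + 1).
  move=> eB ->.
  (* Because [c * mu = - (sigma * kappa)], the cubic terms combine with the factor [sigma ^+ 2 - 1],
     which vanishes. *)
  have -> : sigma ^+ n.+3 * (2 * u - v0 + c * (2 * (v - e)) -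
      (c * mu * (p ^+ 2 + q ^+ 2) + c * xi n) * u) -
      kappa * (p ^+ 2 + q ^+ 2) * (sigma ^+ n.+2 * u) =
      sigma ^+ n.+3 * (2 * u - v0 + c * (2 * (v - e)) - c * xi n * u) +
      (sigma ^+ 2 - 1) * kappa * (p ^+ 2 + q ^+ 2) * sigma ^+ n.+2 * u.
    by rewrite cmu !exprS; ring.
  rewrite sg2 subrr !mul0r addr0 sgn.
  have -> : 2 * u - v0 + c * (2 * (v - e)) - c * xi n * u =
      (2 * u - v0) + c * (2 * (v - e) - xi n * u) by ring.
  have h1 : `|2 * u - v0| <= 2 * `|u| + `|v0|.
    by rewrite (le_trans (ler_normB _ _))// normrM ger0_norm.
  have h2 : `|2 * (v - e) - xi n * u| <= 2 * (`|v| + B) + B * `|u|.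
    rewrite (le_trans (ler_normB _ _))// !normrM (ger0_norm (_ : 0 <= 2))//.
    rewrite lerD// ?ler_wpM2r// ler_wpM2l//.
    by rewrite (le_trans (ler_normB _ _))// lerD2l.
  rewrite (le_trans (ler_normD _ _))// normrM (ger0_norm c0).
  apply: (le_trans (lerD h1 (ler_wpM2l c0 h2))).
  move: (normr_ge0 u) (normr_ge0 v) (normr_ge0 v0) => u0 v1 v2.
  rewrite [leRHS]mulrDl lerD//; first by lra.
  by rewrite -mulrA ler_wpM2l//; nra.
have C0 : 0 <= 2 + c * (2 + 2 * B) by rewrite addr_ge0// mulr_ge0// addr_ge0// mulr_ge0.
split.
  have -> : 2 * p - p0 + c * (2 * (q - b n) - (mu * (p ^+ 2 + q ^+ 2) + xi n) * p) =
    2 * p - p0 + c * (2 * (q - b n)) - (c * mu * (p ^+ 2 + q ^+ 2) + c * xi n) * p by ring.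
  apply: le_trans (key _ p q p0 (b n) bB erefl) _.
  by rewrite ler_wpM2l//; move: (normr_ge0 q0); lra.
have -> : 2 * q - q0 - c * (2 * (p - a n) + (mu * (p ^+ 2 + q ^+ 2) + xi n) * q) =
  2 * q - q0 + c * (2 * (- p - - a n)) - (c * mu * (p ^+ 2 + q ^+ 2) + c * xi n) * q by ring.
have naB : `|- a n| <= B by rewrite normrN.
apply: le_trans (key _ q (- p) q0 (- a n) naB erefl) _.
rewrite ler_wpM2l// normrN.
by move: (normr_ge0 p0); lra.
Qed.

(** On each side one component starts at [N] or [- N] and bounds the other, so the cubic growth
    carries its sign, up to powers of [sigma], to the right boundary node. *)
Lemma shoot_sides (c mu sigma kappa : R) (a b xi : nat -> R) (B : R) (M : nat) :
  0 <= c -> 0 < kappa -> sigma ^+ 2 = 1 -> c * mu = - (sigma * kappa) ->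
  (forall n, [/\ `|a n| <= B, `|b n| <= B & `|xi n| <= B]) ->
  exists N : nat, forall t : R, `|t| <= N%:R ->
    let S x y := shoot c mu a b xi (x, y) M.+1 in
    [/\ 0 < sigma ^+ M * (S N%:R t).1, sigma ^+ M * (S (- N%:R) t).1 < 0,
        0 < sigma ^+ M * (S t N%:R).2 & sigma ^+ M * (S t (- N%:R)).2 < 0].
Proof.
move=> c0 kap0 sg2 cmu bound.
have B0 : 0 <= B by case: (bound 0%N) => + _ _; exact: le_trans.
have C0 : 0 <= 2 + c * (2 + 2 * B) by rewrite addr_ge0// mulr_ge0// addr_ge0// mulr_ge0.
have [L0 HL] := cubic_growth M kap0 C0.
have [N hN] : exists N : nat, L0 <= N%:R.
  by exists (Num.bound `|L0|); apply: le_trans (ler_norm _) (ltW (archi_boundP _)).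
exists N => t ht S.
have rec z := shoot_cubic_recursion z c0 sg2 cmu bound.
(* The recursion weighs node [n] by [sigma ^+ n.+1]: node [1] gets [sigma ^+ 2 = 1], and node [M.+1]
   gets [sigma ^+ M.+2 = sigma ^+ M]. *)
have sgM x : sigma ^+ M.+2 * x = sigma ^+ M * x by rewrite -addn2 exprD sg2 mulr1.
have nsg x : `|sigma ^+ 2 * x| = `|x| by rewrite sg2 mul1r.
rewrite -![sigma ^+ M * _]sgM /S; split.
- apply: (HL N%:R _ _ hN (rec (N%:R, t))); rewrite /= ?mulr0 ?nsg//.
  by rewrite sg2 mul1r.
- rewrite -oppr_gt0.
  apply: (HL N%:R _ _ hN (cubic_recursionN (rec (- N%:R, t)))); rewrite /= ?mulr0 ?oppr0 ?nsg//.
  by rewrite sg2 mul1r opprK.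
- apply: (HL N%:R _ _ hN (cubic_recursion_swap (rec (t, N%:R)))); rewrite /= ?mulr0 ?nsg//.
  by rewrite sg2 mul1r.
- rewrite -oppr_gt0.
  apply: (HL N%:R _ _ hN (cubic_recursionN (cubic_recursion_swap (rec (t, - N%:R)))));
    rewrite /= ?mulr0 ?oppr0 ?nsg//.
  by rewrite sg2 mul1r opprK.
Qed.

End shooting.

(** * One step of the scheme *)

Section complex_components.
Variable R : realType.
Implicit Types (z : R[i]) (a : R).

Lemma complex_eqP z z' : z = z' <-> complex.Re z = complex.Re z' /\ complex.Im z = complex.Im z'.
Proof. by split=> [->//|]; case: z z' => [x y] [x' y'] /= [-> ->]. Qed.

Lemma complex_ReD z z' : complex.Re (z + z') = complex.Re z + complex.Re z'.
Proof. by case: z z' => [x y] [x' y']. Qed.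

Lemma complex_ImD z z' : complex.Im (z + z') = complex.Im z + complex.Im z'.
Proof. by case: z z' => [x y] [x' y']. Qed.

Lemma complex_ReB z z' : complex.Re (z - z') = complex.Re z - complex.Re z'.
Proof. by case: z z' => [x y] [x' y']. Qed.

Lemma complex_ImB z z' : complex.Im (z - z') = complex.Im z - complex.Im z'.
Proof. by case: z z' => [x y] [x' y']. Qed.

Lemma complex_Re_sum (I : finType) (F : I -> R[i]) :
  complex.Re (\sum_i F i) = \sum_i complex.Re (F i).
Proof. by apply: (big_morph _ complex_ReD). Qed.

Lemma complex_Im_sum (I : finType) (F : I -> R[i]) :
  complex.Im (\sum_i F i) = \sum_i complex.Im (F i).
Proof. by apply: (big_morph _ complex_ImD). Qed.

Lemma complex_ReZ a z : complex.Re (a%:C%C * z) = a * complex.Re z.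
Proof. by case: z => x y /=; rewrite mul0r subr0. Qed.

Lemma complex_ImZ a z : complex.Im (a%:C%C * z) = a * complex.Im z.
Proof. by case: z => x y /=; rewrite mul0r addr0. Qed.

Lemma complex_ReiM z : complex.Re (iC R * z) = - complex.Im z.
Proof. by case: z => x y /=; rewrite mul0r mul1r sub0r. Qed.

Lemma complex_ImiM z : complex.Im (iC R * z) = complex.Re z.
Proof. by case: z => x y /=; rewrite mul0r mul1r add0r. Qed.

End complex_components.

Section components.
Variable R : realType.

Lemma half_real_complex : (2^-1 : R[i]) = (2^-1 : R)%:C%C.
Proof. by rewrite fmorphV rmorph_nat. Qed.

Lemma midpoint_Re (M : nat) (U V : 'cV[R[i]]_M) (j : 'I_M) :
  complex.Re (midpoint U V j 0) = 2^-1 * (complex.Re (V j 0) + complex.Re (U j 0)).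
Proof. by rewrite !mxE half_real_complex complex_ReZ complex_ReD. Qed.

Lemma midpoint_Im (M : nat) (U V : 'cV[R[i]]_M) (j : 'I_M) :
  complex.Im (midpoint U V j 0) = 2^-1 * (complex.Im (V j 0) + complex.Im (U j 0)).
Proof. by rewrite !mxE half_real_complex complex_ImZ complex_ImD. Qed.

(** The noise term of the scheme multiplies the midpoint entrywise by [i] times this real vector. *)
Definition noise_potential (M K : nat) (eta : nat -> R) (dbeta : 'cV[R]_K) : 'cV[R]_M :=
  E_mx R M K *m Lambda_mx K eta *m dbeta.

(** Multiplication by [i] exchanges the components with a sign; the cubic and noise terms merge into
    the real diagonal potential [f]. *)
Lemma scheme_stepP (M K : nat) (eta : nat -> R) (lambda tau : R)
    (U V : 'cV[R[i]]_M) (dbeta : 'cV[R]_K) :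
  let p j := complex.Re (midpoint U V j 0) in
  let q j := complex.Im (midpoint U V j 0) in
  let f j := lambda * tau * (p j ^+ 2 + q j ^+ 2) + noise_potential M eta dbeta j 0 in
  let c := tau / mesh R M ^+ 2 in
  scheme_step eta lambda tau U V dbeta <-> forall j,
    complex.Re (V j 0) - complex.Re (U j 0) =
      - (c * (\sum_k laplacian_mx R M j k * q k) + f j * q j) /\
    complex.Im (V j 0) - complex.Im (U j 0) =
      c * (\sum_k laplacian_mx R M j k * p k) + f j * p j.
Proof.
move=> p q f c; rewrite /scheme_step -/c; clearbody c; move: (midpoint U V) @p @q @f => W p q f.
have Zj j : (Z_mx K eta W *m to_C dbeta) j 0 = (noise_potential M eta dbeta j 0)%:C%C * W j 0.
  have -> : Z_mx K eta W *m to_C dbeta = diag_mx W^T *m to_C (noise_potential M eta dbeta).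
    by rewrite /Z_mx /noise_potential /to_C !map_mxM !mulmxA.
  by rewrite mul_diag_mx !mxE mulrC.
have Fj j : (F_mx W *m W) j 0 = (p j ^+ 2 + q j ^+ 2)%:C%C * W j 0.
  by rewrite /F_mx mul_diag_mx !mxE /p /q add_Re2_Im2.
have Lj j : (to_C (laplacian_mx R M) *m W) j 0 = \sum_k (laplacian_mx R M j k)%:C%C * W k 0.
  by rewrite mxE; apply: eq_bigr => k _; rewrite mxE.
move: Zj Fj Lj; move: (Z_mx K eta W *m _) (F_mx W *m W) (to_C _ *m W) => Zm Fm Lm Zj Fj Lj.
have eqj j : ((V - U) j 0 = ((iC R * c%:C%C) *: Lm + (iC R * (lambda * tau)%:C%C) *: Fm + iC R *: Zm) j 0) <->
    complex.Re (V j 0) - complex.Re (U j 0) =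
      - (c * (\sum_k laplacian_mx R M j k * q k) + f j * q j) /\
    complex.Im (V j 0) - complex.Im (U j 0) =
      c * (\sum_k laplacian_mx R M j k * p k) + f j * p j.
  rewrite complex_eqP !mxE Zj Fj Lj -!mulrA !(complex_ReB, complex_ImB, complex_ReD, complex_ImD).
  rewrite !complex_ReiM !complex_ImiM !complex_ReZ !complex_ImZ.
  rewrite complex_Re_sum complex_Im_sum.
  under [in X in X <-> _]eq_bigr do rewrite complex_ImZ.
  have -> : \sum_k complex.Re ((laplacian_mx R M j k)%:C%C * W k 0) =
      \sum_k laplacian_mx R M j k * p k by apply: eq_bigr => k _; rewrite complex_ReZ.
  by split=> -[-> ->]; split; rewrite /f /p /q; ring.
split=> [h j|h]; first by apply/eqj; rewrite h.
by apply/matrixP => j k; rewrite (ord1 k); apply/eqj.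
Qed.

End components.

(** * Charge conservation and uniqueness for one step *)

Section step_properties.
Variable R : realType.

Lemma laplacian_mx_sym (M : nat) (j k : 'I_M) :
  laplacian_mx R M j k = laplacian_mx R M k j.
Proof. by rewrite !mxE eq_sym orbC. Qed.

(** The sum is the real inner product of [p + i q] with [i c A (p + i q)]; the symmetry of [A] makes
    its two halves cancel. *)
Lemma hamiltonian_orthogonal (M : nat) (A : 'M[R]_M) (c : R) (p q : 'I_M -> R) :
  (forall j k, A j k = A k j) ->
  \sum_j (p j * - (c * \sum_k A j k * q k) + q j * (c * \sum_k A j k * p k)) = 0.
Proof.
move=> symA; rewrite big_split /=.
have -> : \sum_j q j * (c * \sum_k A j k * p k) = \sum_j p j * (c * \sum_k A j k * q k).
  under eq_bigr do rewrite mulrCA mulr_sumr; rewrite -mulr_sumr exchange_big /= mulr_sumr.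
  apply: eq_bigr => j _; rewrite mulrCA; congr (_ * _); rewrite mulr_sumr.
  by apply: eq_bigr => k _; rewrite symA; ring.
by rewrite -big_split /= big1// => j _; ring.
Qed.

Lemma cnorm_sqr (M : nat) (U : 'cV[R[i]]_M) :
  cnorm U ^+ 2 = \sum_j (complex.Re (U j 0) ^+ 2 + complex.Im (U j 0) ^+ 2).
Proof. by rewrite sqr_sqrtr// sumr_ge0// => j _; rewrite addr_ge0// sqr_ge0. Qed.

Lemma entry_le_cnorm (M : nat) (U : 'cV[R[i]]_M) (j : 'I_M) :
  complex.Re (U j 0) ^+ 2 + complex.Im (U j 0) ^+ 2 <= cnorm U ^+ 2.
Proof.
rewrite cnorm_sqr (bigD1 j)//= lerDl sumr_ge0// => k _.
by rewrite addr_ge0// sqr_ge0.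
Qed.

Lemma scheme_step_charge (M K : nat) (eta : nat -> R) (lambda tau : R)
    (U V : 'cV[R[i]]_M) (dbeta : 'cV[R]_K) :
  scheme_step eta lambda tau U V dbeta -> cnorm V ^+ 2 = cnorm U ^+ 2.
Proof.
move=> /scheme_stepP stepUV; apply/eqP; rewrite -subr_eq0 !cnorm_sqr -sumrB.
set c := tau / _ in stepUV.
pose p j := complex.Re (midpoint U V j 0).
pose q j := complex.Im (midpoint U V j 0).
(* The potential acts diagonally and cancels node by node, which leaves the pairing with the
   Laplacian. *)
apply/eqP; transitivity (2 * \sum_j (p j * - (c * \sum_k laplacian_mx R M j k * q k) +
    q j * (c * \sum_k laplacian_mx R M j k * p k))); last first.
  by rewrite hamiltonian_orthogonal ?mulr0//; exact: laplacian_mx_sym.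
rewrite mulr_sumr; apply: eq_bigr => j _.
have [+ +] := stepUV j; rewrite -/(p j) -/(q j).
have hp : complex.Re (V j 0) + complex.Re (U j 0) = 2 * p j.
  by rewrite /p midpoint_Re mulrA divff ?mul1r.
have hq : complex.Im (V j 0) + complex.Im (U j 0) = 2 * q j.
  by rewrite /q midpoint_Im mulrA divff ?mul1r.
move=> h1 h2.
rewrite opprD addrACA !subr_sqr h1 h2 hp hq.
by rewrite /p /q; ring.
Qed.

(** With [D = d + i e] and the mean [m = s + i t], the expression is twice the product of the real
    and imaginary parts of [D] times the conjugate of [m]. Its modulus is at most [|D|^2 |m|^2], and
    [m] lies in the unit disc by convexity. *)
Lemma cubic_monotonicity (p q p' q' : R) :
  let d := p - p' in let e := q - q' in
  let r := p ^+ 2 + q ^+ 2 in let r' := p' ^+ 2 + q' ^+ 2 in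
  r <= 1 -> r' <= 1 ->
  `|e * (r * p - r' * p') - d * (r * q - r' * q')| <= d ^+ 2 + e ^+ 2.
Proof.
move=> d e r r' r1 r1'.
pose s := (p + p') / 2; pose t := (q + q') / 2.
have -> : e * (r * p - r' * p') - d * (r * q - r' * q') =
    2 * (d * s + e * t) * (e * s - d * t).
  by rewrite /d /e /r /r' /s /t; field.
have st : s ^+ 2 + t ^+ 2 <= 1.
  rewrite /s /t; move: r1 r1'; rewrite /r /r'.
  have := sqr_ge0 (p - p'); have := sqr_ge0 (q - q'); nra.
have h : (d * s + e * t) ^+ 2 + (e * s - d * t) ^+ 2 <= d ^+ 2 + e ^+ 2.
  have -> : (d * s + e * t) ^+ 2 + (e * s - d * t) ^+ 2 =
    (d ^+ 2 + e ^+ 2) * (s ^+ 2 + t ^+ 2) by ring.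
  by rewrite ler_piMr// addr_ge0// sqr_ge0.
apply: le_trans h; move: (d * s + e * t) (e * s - d * t) => x y.
by rewrite ler_norml; apply/andP; split;
  have := sqr_ge0 (x + y); have := sqr_ge0 (x - y); nra.
Qed.

(* The linear part of the scheme is skew-adjoint, so that only the cubic term
   contributes to the norm of the difference of two midpoints. *)
Lemma scheme_step_unique (M K : nat) (eta : nat -> R) (lambda tau : R)
    (U V V' : 'cV[R[i]]_M) (dbeta : 'cV[R]_K) :
  `|lambda| = 1 -> 0 < tau -> tau < 2 -> cnorm U = 1 ->
  scheme_step eta lambda tau U V dbeta -> scheme_step eta lambda tau U V' dbeta ->
  V = V'.
Proof.
move=> lam1 tau0 tau2 U1 sV sV'.
have mid_le1 (W : 'cV[R[i]]_M) j : scheme_step eta lambda tau U W dbeta ->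
    complex.Re (midpoint U W j 0) ^+ 2 + complex.Im (midpoint U W j 0) ^+ 2 <= 1.
  move=> /scheme_step_charge; rewrite U1 expr1n => W1.
  have hW := entry_le_cnorm W j; have hU := entry_le_cnorm U j.
  rewrite W1 in hW; rewrite U1 expr1n in hU; rewrite midpoint_Re midpoint_Im.
  move: (complex.Re (U j 0)) (complex.Im (U j 0)) hU (complex.Re (W j 0)) (complex.Im (W j 0)) hW.
  move=> a b hU a' b' hW.
  have := sqr_ge0 (a - a'); have := sqr_ge0 (b - b'); nra.
have rV := mid_le1 V ^~ sV; have rV' := mid_le1 V' ^~ sV'.
move/scheme_stepP: sV => sV; move/scheme_stepP: sV' => sV'.
set c := tau / _ in sV sV'.
pose p j := complex.Re (midpoint U V j 0); pose q j := complex.Im (midpoint U V j 0).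
pose p' j := complex.Re (midpoint U V' j 0); pose q' j := complex.Im (midpoint U V' j 0).
pose d j := p j - p' j; pose e j := q j - q' j.
pose r j := p j ^+ 2 + q j ^+ 2; pose r' j := p' j ^+ 2 + q' j ^+ 2.
have hp j : complex.Re (V j 0) - complex.Re (V' j 0) = 2 * d j.
  by rewrite /d /p /p' !midpoint_Re; field.
have hq j : complex.Im (V j 0) - complex.Im (V' j 0) = 2 * e j.
  by rewrite /e /q /q' !midpoint_Im; field.
have sumd (x y : 'I_M -> R) j : \sum_k laplacian_mx R M j k * (x k - y k) =
    \sum_k laplacian_mx R M j k * x k - \sum_k laplacian_mx R M j k * y k.
  by rewrite -sumrB; apply: eq_bigr => k _; rewrite mulrBr.
(* The two steps are subtracted and paired with the difference of the midpoints; the old state, the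
   noise and the Laplacian drop out. *)
have energy : 2 * \sum_j (d j ^+ 2 + e j ^+ 2) =
    lambda * tau * \sum_j (e j * (r j * p j - r' j * p' j) - d j * (r j * q j - r' j * q' j)).
  have ham := hamiltonian_orthogonal c d e (@laplacian_mx_sym M).
  rewrite -[RHS]addr0 -[X in _ + X]ham !mulr_sumr -big_split /=; apply: eq_bigr => j _.
  have [h1 h2] := sV j; have [h1' h2'] := sV' j.
  rewrite /d /e !sumd -/(d j) -/(e j).
  have -> : 2 * (d j ^+ 2 + e j ^+ 2) = d j * ((complex.Re (V j 0) - complex.Re (U j 0)) -
     (complex.Re (V' j 0) - complex.Re (U j 0))) + e j * ((complex.Im (V j 0) - complex.Im (U j 0)) -
     (complex.Im (V' j 0) - complex.Im (U j 0))).
    rewrite [X in d j * X](_ : _ = 2 * d j); last by rewrite -hp; ring.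
    by rewrite [X in e j * X](_ : _ = 2 * e j); [ring|rewrite -hq; ring].
  rewrite h1 h2 h1' h2' -/(p j) -/(q j) -/(p' j) -/(q' j) /r /r' /d /e /p /q /p' /q'.
  by ring.
have le_energy : 2 * \sum_j (d j ^+ 2 + e j ^+ 2) <= tau * \sum_j (d j ^+ 2 + e j ^+ 2).
  rewrite energy; apply: le_trans (ler_norm _) _.
  rewrite normrM normrM lam1 mul1r (gtr0_norm tau0) ler_wpM2l ?(ltW tau0)//.
  apply: le_trans (ler_norm_sum _ _ _) _; apply: ler_sum => j _.
  exact: (cubic_monotonicity (rV j) (rV' j)).
have sum0 : \sum_j (d j ^+ 2 + e j ^+ 2) == 0.
  rewrite eq_le sumr_ge0 ?andbT; last by move=> j _; rewrite addr_ge0// sqr_ge0.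
  by move: le_energy; rewrite -subr_ge0 -mulrBl nmulr_rge0// subr_lt0.
have de0 j : d j = 0 /\ e j = 0.
  move: sum0; rewrite psumr_eq0; last by move=> k _; rewrite addr_ge0// sqr_ge0.
  move=> /allP/(_ j (mem_index_enum _))/=.
  by rewrite paddr_eq0 ?sqr_ge0// !sqrf_eq0 => /andP[/eqP -> /eqP ->].
apply/matrixP => j k; rewrite (ord1 k); apply/complex_eqP.
have [d0 e0] := de0 j.
by split; apply/eqP; rewrite -subr_eq0 ?hp ?hq ?d0 ?e0 mulr0.
Qed.

End step_properties.

(** * Existence of a measurable step *)

Lemma sum_ord_eq (V : nmodType) (M m : nat) (F : nat -> V) :
  \sum_(k < M) (if k == m :> nat then F k else 0) = if (m < M)%N then F m else 0.
Proof.
rewrite -big_mkcond /=; case: ltnP => [ltmM|leMm].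
  by rewrite (big_pred1 (Ordinal ltmM)).
by rewrite big_pred0// => k; apply/negbTE; rewrite neq_ltn (leq_trans (ltn_ord k) leMm).
Qed.

(** The zero boundary values stand in for the neighbours that the first and last rows of the matrix
    lack. *)
Lemma laplacian_mx_sum (R : realType) (M : nat) (g : nat -> R) (j : 'I_M) :
  g 0%N = 0 -> g M.+1 = 0 ->
  \sum_k laplacian_mx R M j k * g k.+1 = g j.+2 - 2 * g j.+1 + g j.
Proof.
move=> g0 gM.
(* At [j = 0] the predecessor [j.-1] is [0] again; the factor [(0 < j)%N%:R] discards this spurious
   neighbour. *)
have -> : \sum_k laplacian_mx R M j k * g k.+1 =
    \sum_(k < M) ((if k == j.+1 :> nat then g k.+1 else 0) +
                  (if k == j :> nat then - 2 * g k.+1 else 0) +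
                  (if k == j.-1 :> nat then (0 < j)%N%:R * g k.+1 else 0)).
  apply: eq_bigr => k _; rewrite mxE -val_eqE/=.
  move: (nat_of_ord j) (nat_of_ord k) => a b; case: a => [|a] /=;
    repeat (case: ifP => ?); rewrite ?mulr0n ?mulr1n; try (exfalso; lia); ring.
rewrite !big_split /= (sum_ord_eq _ _ (fun k => g k.+1)).
rewrite (sum_ord_eq _ _ (fun k => - 2 * g k.+1)) (sum_ord_eq _ _ (fun k => (0 < j)%N%:R * g k.+1)).
rewrite ltn_ord (leq_ltn_trans (leq_pred j) (ltn_ord j)).
have -> : (if (j.+1 < M)%N then g j.+2 else 0) = g j.+2.
  case: ltnP => // leM; suff <- : M = j.+1 by [].
  by apply/eqP; rewrite eqn_leq leM ltn_ord.
have -> : (0 < j)%N%:R * g j.-1.+1 = g j.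
  by case: (nat_of_ord j) => [|m]; rewrite ?g0 ?mul0r ?mul1r.
by rewrite mulNr.
Qed.

Lemma noise_potential_measurable d (T : measurableType d) (R : realType) (M K : nat)
    (eta : nat -> R) (dbeta : T -> 'cV[R]_K) (j : 'I_M) :
  (forall k, measurable_fun setT (fun w => dbeta w k 0)) ->
  measurable_fun setT (fun w => noise_potential M eta (dbeta w) j 0).
Proof.
move=> mb; rewrite /noise_potential; under eq_fun do rewrite mxE.
apply: measurable_sum => k; apply: measurable_funM => //.
Qed.

(** The midpoint is a shooting trajectory that vanishes at the right boundary node, started from a
    measurable zero; the new state is twice the midpoint minus the old one. *)
Lemma scheme_step_exists d (T : measurableType d) (R : realType) (M K : nat)
    (eta : nat -> R) (lambda tau : R) (U : T -> 'cV[R[i]]_M) (dbeta : T -> 'cV[R]_K) :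
  lambda ^+ 2 = 1 -> 0 < tau -> random_cvector U ->
  (forall k, measurable_fun setT (fun w => dbeta w k 0)) ->
  exists V : T -> 'cV[R[i]]_M, random_cvector V /\
    forall w, scheme_step eta lambda tau (U w) (V w) (dbeta w).
Proof.
move=> lam2 tau0 mU mb.
pose ext (f : 'I_M -> T -> R) n w := if insub n is Some j then f j w else 0.
have extE f (j : 'I_M) w : ext f j w = f j w by rewrite /ext valK.
have mext f n : (forall j, measurable_fun setT (f j)) -> measurable_fun setT (ext f n).
  by move=> mf; rewrite /ext; case: insub => [j|]; [exact: mf|exact: measurable_cst].
pose fa j w := complex.Re (U w j 0); pose fb j w := complex.Im (U w j 0).
pose fx j w := noise_potential M eta (dbeta w) j 0.
have mfa n : measurable_fun setT (ext fa n) by apply: mext => j; have [] := mU j.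
have mfb n : measurable_fun setT (ext fb n) by apply: mext => j; have [] := mU j.
have mfx n : measurable_fun setT (ext fx n).
  by apply: mext => j; exact: noise_potential_measurable.
have extB f w n : `|ext f n w| <= \sum_j `|f j w|.
  rewrite /ext; case: insub => [j|]; last by rewrite normr0 sumr_ge0.
  by rewrite (bigD1 j)//= lerDl sumr_ge0.
pose c := (tau / mesh R M ^+ 2)^-1.
have mesh0 : 0 < mesh R M by rewrite invr_gt0.
have c0 : 0 < c by rewrite invr_gt0 divr_gt0// exprn_gt0.
pose S w x y n := shoot c (lambda * tau) (ext fa ^~ w) (ext fb ^~ w) (ext fx ^~ w) (x, y) n.
have sg2 : (- lambda) ^+ 2 = 1 by rewrite sqrrN.
have mS n x y : measurable_fun setT x -> measurable_fun setT y ->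
    measurable_fun setT (fun w => (S w (x w) (y w) n).1) /\
    measurable_fun setT (fun w => (S w (x w) (y w) n).2).
  by move=> mx my; exact: shoot_measurable.
have [x [y [mx my xy0]]] : exists x y : T -> R,
    [/\ measurable_fun setT x, measurable_fun setT y & forall w,
      (- lambda) ^+ M * (S w (x w) (y w) M.+1).1 = 0 /\
      (- lambda) ^+ M * (S w (x w) (y w) M.+1).2 = 0].
  (* The factor [(- lambda) ^+ M] normalises the signs on the sides and, being nonzero, does not
     change the zeros. *)
  apply: (measurable_zero (P := fun w x y => (- lambda) ^+ M * (S w x y M.+1).1)
                          (Q := fun w x y => (- lambda) ^+ M * (S w x y M.+1).2)).
  - move=> x y mx my; have [h1 h2] := mS M.+1 x y mx my.
    by split; apply: measurable_funM => //; exact: measurable_cst.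
  - move=> w; have [h1 h2] := shoot_continuous c (lambda * tau) (ext fa ^~ w) (ext fb ^~ w)
      (ext fx ^~ w) M.+1.
    have etaS (z : R * R) : S w z.1 z.2 M.+1 =
        shoot c (lambda * tau) (ext fa ^~ w) (ext fb ^~ w) (ext fx ^~ w) z M.+1 by case: z.
    split; under eq_fun do rewrite etaS; move=> z; apply: cvgM;
      [exact: cvg_cst|exact: h1|exact: cvg_cst|exact: h2].
  (* Here [sigma = - lambda] and [kappa = c * tau]; the sum of all moduli bounds the data at every
     node. *)
  - move=> w; apply: (@shoot_sides _ c (lambda * tau) (- lambda) (c * tau) _ _ _
      (\sum_j `|fa j w| + \sum_j `|fb j w| + \sum_j `|fx j w|)) => //.
    + exact: ltW.
    + exact: mulr_gt0.
    + by ring.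
    + have h f : 0 <= \sum_j `|f j w : R| by rewrite sumr_ge0.
      move=> n; split; apply: (le_trans (extB _ _ _)).
      * by rewrite -addrA lerDl addr_ge0.
      * by rewrite addrAC lerDr addr_ge0.
      * by rewrite lerDr addr_ge0.
have lam0 : (- lambda) ^+ M != 0.
  by rewrite expf_neq0// -sqrf_eq0 sg2 oner_eq0.
pose p w n := (S w (x w) (y w) n).1; pose q w n := (S w (x w) (y w) n).2.
have [p0 q0] : (forall w, p w M.+1 = 0) /\ (forall w, q w M.+1 = 0).
  by split=> w; have [/eqP + /eqP] := xy0 w; rewrite !mulf_eq0 (negPf lam0) => /eqP ? /eqP ?.
exists (fun w => \col_j Complex (2 * p w j.+1 - fa j w) (2 * q w j.+1 - fb j w)); split.
  move=> j; have [m1 m2] := mS j.+1 x y mx my; have [m3 m4] := mU j.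
  split; under eq_fun do rewrite mxE /=; apply: measurable_funB => //;
    by apply: measurable_funM => //; exact: measurable_cst.
move=> w; apply/scheme_stepP => j; set V := \col_j _.
have VE k : V k 0 = Complex (2 * p w k.+1 - fa k w) (2 * q w k.+1 - fb k w) by rewrite mxE.
have mRe k : complex.Re (midpoint (U w) V k 0) = p w k.+1.
  by rewrite midpoint_Re VE /= /fa; field.
have mIm k : complex.Im (midpoint (U w) V k 0) = q w k.+1.
  by rewrite midpoint_Im VE /= /fb; field.
rewrite !mRe !mIm.
under eq_bigr do rewrite mIm; under [in X in _ /\ X]eq_bigr do rewrite mRe.
rewrite !laplacian_mx_sum// VE /= -/(fa j w) -/(fb j w) -/(fx j w).
have -> : tau / mesh R M ^+ 2 = c^-1 by rewrite invrK.
have -> : p w j.+2 = 2 * p w j.+1 - p w j + c * (2 * (q w j.+1 - fb j w) -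
  (lambda * tau * (p w j.+1 ^+ 2 + q w j.+1 ^+ 2) + fx j w) * p w j.+1).
  by rewrite {1}/p /S shootSS /shoot_next !extE.
have -> : q w j.+2 = 2 * q w j.+1 - q w j - c * (2 * (p w j.+1 - fa j w) +
  (lambda * tau * (p w j.+1 ^+ 2 + q w j.+1 ^+ 2) + fx j w) * q w j.+1).
  by rewrite {1}/q /S shootSS /shoot_next !extE.
by split; field; rewrite gt_eqF.
Qed.

(* Uniqueness fails for large time steps (already for M = K = 1, lambda = 1,
   tau = 10 the implicit step has three solutions with positive probability),
   whence the bound on tau, which concerns the uniqueness clause only. *)
Theorem proposition3p1 (R : realType) (d : measure_display)
    (T : measurableType d) (P : probability T R)
    (M K : nat) (hMK : (M <= K)%N)
    (eta : nat -> R) (eta_gt0 : forall k, (0 < k)%N -> 0 < eta k)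
    (eta_sum : (\sum_(1 <= k <oo) (eta k)%:E < +oo)%E)
    (lambda : R) (hlambda : lambda = 1 \/ lambda = -1)
    (tau : R) (tau_gt0 : 0 < tau)
    (beta : 'I_K -> R -> {RV P >-> R})
    (hbeta : independent_brownian_motions beta)
    (U0 : 'cV[R[i]]_M) (hU0 : unit_sphere U0) :
  [/\ exists U, scheme_solution eta lambda tau beta U0 U,
      tau < 2 -> forall U V,
        scheme_solution eta lambda tau beta U0 U ->
        scheme_solution eta lambda tau beta U0 V ->
        forall n, {ae P, forall w, U n w = V n w} &
      forall U, scheme_solution eta lambda tau beta U0 U ->
        forall n, {ae P, forall w,
          cnorm (U n.+1 w) ^+ 2 = cnorm (U n w) ^+ 2 /\
          cnorm (U n w) ^+ 2 = 1}].
Proof.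
have lam2 : lambda ^+ 2 = 1 by case: hlambda => ->; rewrite ?sqrrN expr1n.
have lamn : `|lambda| = 1 by case: hlambda => ->; rewrite ?normrN normr1.
have charge U : scheme_solution eta lambda tau beta U0 U ->
    forall n, {ae P, forall w, cnorm (U n w) ^+ 2 = 1}.
  move=> [_ U0E step]; elim=> [|n IH].
    by apply: filterS U0E => w ->; rewrite hU0 expr1n.
  by apply: filterS2 (step n) IH => w /scheme_step_charge -> ->.
split.
(* Measurability is bundled with each state, so that the recursively chosen states are random
   vectors; the choice also depends on [n], through the increment. *)
- pose RV := {X : T -> 'cV[R[i]]_M | random_cvector X}.
  pose dB n w : 'cV[R]_K := \col_k increment (beta k) (n%:R * tau) (n.+1%:R * tau) w.
  have mdB n k : measurable_fun setT (fun w => dB n w k 0).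
    under eq_fun do rewrite mxE; rewrite /increment.
    exact: measurable_funB.
  have /choice[next nextP] : forall nX : nat * RV, exists Y : RV, forall w,
      scheme_step eta lambda tau (sval nX.2 w) (sval Y w) (dB nX.1 w).
    move=> [n [X mX]].
    by have [Y [mY stepY]] := scheme_step_exists eta lam2 tau_gt0 mX (mdB n); exists (exist _ Y mY).
  have mU0 : random_cvector (fun _ : T => U0) by move=> j; split; exact: measurable_cst.
  pose u := nat_rect (fun _ => RV) (exist _ _ mU0) (fun n X => next (n, X)).
  exists (fun n => sval (u n)); split.
  + by move=> n; exact: svalP.
  + exact: aeW.
  + by move=> n; apply: aeW => w; exact: (nextP (n, u n)).
- move=> tau2 U V solU solV; elim=> [|n IH].
    have [_ UE _] := solU; have [_ VE _] := solV.
    by apply: filterS2 UE VE => w -> ->.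
  have [_ _ /(_ n) stepU] := solU; have [_ _ /(_ n) stepV] := solV.
  have chU := charge U solU n.
  have IHc : {ae P, forall w, U n w = V n w /\ cnorm (U n w) = 1}.
    apply: filterS2 IH chU => w -> /eqP; rewrite sqrf_eq1 => /orP[/eqP //|/eqP cN].
    by have := sqrtr_ge0 (\sum_(j < M) (complex.Re (V n w j 0) ^+ 2 +
      complex.Im (V n w j 0) ^+ 2)); rewrite -/(cnorm _) cN oppr_ge0 ler10.
  apply: filterS3 IHc stepU stepV => w [UV U1] sU sV.
  by apply: scheme_step_unique lamn tau_gt0 tau2 U1 sU _; rewrite UV.
- move=> U solU n; apply: filterS2 (charge U solU n.+1) (charge U solU n) => w c1 c0.
  by rewrite c1 c0.
Qed.
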